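(* Let $A$ be a ring, $S=A[\underline{t};\sigma,\underline{\delta}]$ a multivariate Ore extension in $n$ variables and $f=f(\underline{t})\in S$. Let $\underline{a},\underline{b}\in A^n$ be such that there exists $x\in A$, not a zero divisor, with $\underline{b}x=\sigma(x)\underline{a}+\underline{\delta}(x)$. Then: (1) For any $y\in A$, $f(T_{\underline{b}})(y)\,x=f(T_{\underline{a}})(yx)$. (2) $x\in\ker f(T_{\underline{a}})$ if and only if $f(\underline{b})=0$. In particular, if $x\in U(A)$ (the group of units of $A$), then $x\in \ker f(T_{\underline{a}})$ if and only if $f(\underline{a}^x)=0$.
   Context: All rings are associative with identity, and ring homomorphisms preserve the identity. Let $A$ be a ring, $n\ge 1$, $\sigma:A\to M_n(A)$ a ring homomorphism, and write $\sigma_{ij}(a)$ for the $(i,j)$ entry of $\sigma(a)$. Let $\underline{\delta}=(\delta_1,\dots,\delta_n)^t$ be a column of additive maps $A\to A$ forming a $\sigma$-derivation: $\delta_i(ab)=\sum_{j=1}^n\sigma_{ij}(a)\delta_j(b)+\delta_i(a)b$ for all $a,b\in A$, $1\le i\le n$. The multivariate Ore extension $S=A[\underline{t};\sigma,\underline{\delta}]$ is the ring of (finite) sums $\sum_{m\in M}\alpha_m m$, $\alpha_m\in A$, where $M$ is the free monoid on the variables $t_1,\dots,t_n$ (so $S$ is a free left $A$-module with basis $M$), with multiplication determined by concatenation in $M$ and the rules $t_ia=\sum_{j=1}^n\sigma_{ij}(a)t_j+\delta_i(a)$ for $a\in A$, $1\le i\le n$. Elements of $A^n$ are columns; $\underline{b}x$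 is the column with entries $b_ix$, $\sigma(x)\underline{a}$ is a matrix-column product, and $\underline{\delta}(x)=(\delta_1(x),\dots,\delta_n(x))^t$. Evaluation: for $\underline{a}=(a_1,\dots,a_n)^t\in A^n$ let $I=S(t_1-a_1)+\cdots+S(t_n-a_n)$, a left ideal of $S$. Every class in $S/I$ is represented by a unique element of $A$; the evaluation $f(\underline{a})$ is the element of $A$ representing $f(\underline{t})+I$. The map $T_{\underline{a}}$: $T_{\underline{a}}=(T_{a_1},\dots,T_{a_n})^t$, where $T_{a_i}:A\to A$ is the additive map $T_{a_i}(b)=\sum_{j=1}^n\sigma_{ij}(b)a_j+\delta_i(b)$. For $f=\sum_m\alpha_m m\in S$, $f(T_{\underline{a}})\in \mathrm{End}(A,+)$ is obtained by replacing each $t_i$ by $T_{a_i}$ (words become compositions) and each coefficient $\alpha$ by left multiplication by $\alpha$ on $A$. Conjugation: for $x\in U(A)$, $\underline{a}^x=\sigma(x)\underline{a}x^{-1}+\underline{\delta}(x)x^{-1}$. *)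

(* Defs.v *)
From HB Require Import structures.
From mathcomp Require Import all_boot all_order all_algebra.
From mathcomp Require Import finmap monalg.
From mathcomp Require Import boolp.

Set Implicit Arguments.
Unset Strict Implicit.
Unset Printing Implicit Defensive.

Import GRing.Theory.
Local Open Scope ring_scope.

Definition cvmulr (A : pzRingType) (n : nat) (u : 'cV[A]_n) (x : A) :
  'cV[A]_n := \col_i (u i 0 * x).

Definition zero_divisor (A : pzRingType) (x : A) : Prop :=
  exists2 y : A, y != 0 & (x * y = 0 \/ y * x = 0).

Record sigma_derivation (A : pzRingType) (n : nat)
    (sigma : {rmorphism A -> 'M[A]_n}) := SigmaDerivation {
  sderiv_fun :> {additive A -> 'cV[A]_n};
  sderivM : forall a b : A,
    sderiv_fun (a * b) = sigma a *m sderiv_fun b + cvmulr (sderiv_fun a) b }.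

Section MalgLift.
Context (K : choiceType) (G V : zmodType) (F : K -> G -> V).
Context (FB : forall k, {morph F k : x y / x - y}).

Definition mlift (g : {malg G[K]}) : V := \sum_(k <- msupp g) F k g@_k.

Lemma mlift_F0 k : F k 0 = 0.
Proof. by rewrite -[X in F k X](subrr 0) FB subrr. Qed.

Lemma mliftEw (d : {fset K}) (g : {malg G[K]}) :
  (msupp g `<=` d)%fset -> mlift g = \sum_(k <- d) F k g@_k.
Proof.
move=> le; rewrite /mlift (big_fset_incl _ le) // => k _ kg.
by rewrite (mcoeff_outdom kg) mlift_F0.
Qed.

Lemma mliftB : {morph mlift : f g / f - g}.
Proof.
move=> f g; pose d := (msupp f `|` msupp g)%fset.
rewrite (@mliftEw d f) ?fsubsetUl // (@mliftEw d g) ?fsubsetUr //.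
rewrite (@mliftEw d) ?msuppB_le // -sumrB.
by apply: eq_bigr => k _; rewrite mcoeffB FB.
Qed.

Lemma mliftU k c : mlift << c *g k >> = F k c.
Proof.
rewrite (mliftEw msuppU_le) big_seq_fset1 mcoeffUU //.
Qed.

End MalgLift.

Section WordAction.
Context (A : pzRingType) (n : nat) (V : zmodType).
Context (s : A -> V -> V) (X : 'I_n -> V -> V).

(* sum_m alpha_m m acts on V: each t_i as [X i], so that a word acts as a
   composition, and each coefficient through [s]. *)
Definition word_act (f : {malg A[{fmonom 'I_n}]}) (v : V) : V :=
  \sum_(m <- msupp f) s f@_m (foldr X v m).

Context (sBl : forall v, {morph s^~ v : c d / c - d}).
Context (sBr : forall c, {morph s c : v w / v - w}).
Context (XB : forall i, {morph X i : v w / v - w}).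

Lemma word_act_wordB m : {morph (fun v => foldr X v m) : v w / v - w}.
Proof. by elim: m => //= i m IH v w; rewrite IH XB. Qed.

Lemma word_actBl v : {morph word_act^~ v : f g / f - g}.
Proof.
by apply: (@mliftB _ _ _ (fun (m : {fmonom 'I_n}) c => s c (foldr X v m))).
Qed.

Lemma word_actBr f : {morph word_act f : v w / v - w}.
Proof.
move=> v w; rewrite /word_act -sumrB; apply: eq_bigr => m _.
by rewrite word_act_wordB sBr.
Qed.

Lemma word_actU c (m : {fmonom 'I_n}) v :
  word_act << c *g m >> v = s c (foldr X v m).
Proof.
by apply: (@mliftU _ _ _ (fun (m : {fmonom 'I_n}) c => s c (foldr X v m))).
Qed.

Lemma word_actE f v : word_act f v = \sum_(m <- msupp f) s f@_m (foldr X v m).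
Proof. by []. Qed.

End WordAction.

#[local] Opaque word_act.

Lemma morphB_0 (U V : zmodType) (h : U -> V) :
  {morph h : x y / x - y} -> h 0 = 0.
Proof. by move=> hB; rewrite -[X in h X](subrr 0) hB subrr. Qed.

Lemma morphB_D (U V : zmodType) (h : U -> V) :
  {morph h : x y / x - y} -> {morph h : x y / x + y}.
Proof.
by move=> hB x y; rewrite -{1}[y]opprK hB -[- y]sub0r hB (morphB_0 hB) sub0r opprK.
Qed.

Lemma morphB_sum (U V : zmodType) (h : U -> V) (I : Type) (r : seq I) F :
  {morph h : x y / x - y} -> h (\sum_(i <- r) F i) = \sum_(i <- r) h (F i).
Proof. by move=> hB; apply: (big_morph h (morphB_D hB) (morphB_0 hB)). Qed.

Lemma sum_addB (V : zmodType) (I : finType) (F G : I -> V) (u v : V) :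
  \sum_i F i + u - (\sum_i G i + v) = \sum_i (F i - G i) + (u - v).
Proof. by rewrite opprD addrACA -sumrB. Qed.

Section OreProduct.
Context (A : pzRingType) (n : nat) (sigma : {rmorphism A -> 'M[A]_n}).
Context (delta : sigma_derivation sigma).

(* [{fmonom 'I_n}] is the free monoid on t_1, ..., t_n; only the left A-module
   structure of [malg] is used, not its monoid-algebra product. *)
Local Notation fmod := {malg A[{fmonom 'I_n}]}.

Definition ore_scale (c : A) (g : fmod) : fmod :=
  \sum_(m <- msupp g) << c * g@_m *g m >>.

(* t_i (sum_m alpha_m m) =
     sum_m (sum_j sigma_ij(alpha_m) t_j m + delta_i(alpha_m) m) *)
Definition ore_mulX (i : 'I_n) (g : fmod) : fmod :=
  \sum_(m <- msupp g)
    (\sum_j << sigma g@_m i j *g mmul (fmu j) m >> + << delta g@_m i 0 *g m >>).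

Definition ore_one : fmod := << 1 *g mone >>.

Definition ore_mul (f g : fmod) : fmod := word_act ore_scale ore_mulX f g.

Lemma oreE (g : fmod) : g = \sum_(m <- msupp g) << g@_m *g m >>.
Proof. exact: monalgE. Qed.

Lemma ore_scaleBr c : {morph ore_scale c : g h / g - h}.
Proof.
apply: (@mliftB _ _ _ (fun (m : {fmonom 'I_n}) a => << c * a *g m >>)).
by move=> m a b; rewrite /= mulrBr monalgUB.
Qed.

Lemma ore_scaleU c a m : ore_scale c << a *g m >> = << c * a *g m >>.
Proof.
apply: (@mliftU _ _ _ (fun (m : {fmonom 'I_n}) a => << c * a *g m >>)).
by move=> k x y; rewrite /= mulrBr monalgUB.
Qed.

Lemma ore_scaleBl g : {morph ore_scale^~ g : c d / c - d}.
Proof.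
move=> c d; rewrite /ore_scale -sumrB; apply: eq_bigr => m _.
by rewrite mulrBl monalgUB.
Qed.

Lemma ore_mulX_monoB i (m : {fmonom 'I_n}) :
  {morph (fun c => \sum_j << sigma c i j *g mmul (fmu j) m >>
                   + << delta c i 0 *g m >> : fmod) : a b / a - b}.
Proof.
move=> a b /=; rewrite !raddfB !mxE monalgUB opprD addrACA -sumrB; congr (_ + _).
by apply: eq_bigr => j _; rewrite !mxE monalgUB.
Qed.

Lemma ore_mulXB i : {morph ore_mulX i : g h / g - h}.
Proof. exact: (mliftB (ore_mulX_monoB i)). Qed.

Lemma ore_mulXU i c m : ore_mulX i << c *g m >> =
  \sum_j << sigma c i j *g mmul (fmu j) m >> + << delta c i 0 *g m >>.
Proof. exact: (mliftU (ore_mulX_monoB i)). Qed.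

Lemma ore_ext (V : zmodType) (h k : fmod -> V) :
  {morph h : x y / x - y} -> {morph k : x y / x - y} ->
  (forall c m, h << c *g m >> = k << c *g m >>) -> h =1 k.
Proof.
move=> hB kB e g; rewrite (oreE g) (morphB_sum _ _ hB) (morphB_sum _ _ kB).
exact: eq_bigr.
Qed.

Lemma fmonom_ind (P : {fmonom 'I_n} -> Prop) :
  P mone -> (forall i m, P m -> P (mmul (fmu i) m)) -> forall m, P m.
Proof.
move=> P1 Pm [s]; elim: s => [|i s /Pm -/(_ i)]; first by rewrite -fmoneE.
suff -> : mmul (fmu i) (FMonom s) = FMonom (i :: s) by [].
by apply: val_inj; rewrite /= fmM fmU.
Qed.

Lemma ore_scale1 : ore_scale 1 =1 id.
Proof.
by move=> g; rewrite [RHS](oreE g) /ore_scale; apply: eq_bigr => m _; rewrite mul1r.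
Qed.

Lemma ore_scaleA c d g : ore_scale c (ore_scale d g) = ore_scale (c * d) g.
Proof.
apply: (@ore_ext _ (fun g => ore_scale c (ore_scale d g))).
- by move=> x y; rewrite !ore_scaleBr.
- exact: ore_scaleBr.
by move=> a m; rewrite !ore_scaleU mulrA.
Qed.

Lemma ore_mulX_scale i c g : ore_mulX i (ore_scale c g) =
  \sum_j ore_scale (sigma c i j) (ore_mulX j g) + ore_scale (delta c i 0) g.
Proof.
apply: (@ore_ext _ (fun g => ore_mulX i (ore_scale c g))
  (fun g => \sum_j ore_scale (sigma c i j) (ore_mulX j g)
            + ore_scale (delta c i 0) g)) => [x y|x y|a m].
- by rewrite ore_scaleBr ore_mulXB.
- rewrite ore_scaleBr; apply: etrans (esym (sum_addB _ _ _ _)).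
  by congr (_ + _); apply: eq_bigr => j _; rewrite ore_mulXB ore_scaleBr.
rewrite !ore_scaleU ore_mulXU rmorphM sderivM !mxE monalgUD addrA.
congr (_ + _).
transitivity (\sum_j (\sum_k << sigma c i j * sigma a j k *g mmul (fmu k) m >>
   + << sigma c i j * delta a j 0 *g m >>) : fmod); last first.
  apply: eq_bigr => j _; rewrite ore_mulXU (morphB_D (ore_scaleBr _)) ore_scaleU.
  rewrite (morphB_sum _ _ (ore_scaleBr _)); congr (_ + _).
  by apply: eq_bigr => k _; rewrite ore_scaleU.
rewrite big_split /= raddf_sum exchange_big /=; congr (_ + _).
by apply: eq_bigr => k _; rewrite !mxE raddf_sum.
Qed.

Section Module.
Context (V : zmodType) (s : A -> V -> V) (X : 'I_n -> V -> V).
Context (sBl : forall v, {morph s^~ v : c d / c - d}).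
Context (sBr : forall c, {morph s c : v w / v - w}).
Context (XB : forall i, {morph X i : v w / v - w}).
Context (sA : forall c d v, s c (s d v) = s (c * d) v).
Context (Xs : forall i c v,
  X i (s c v) = \sum_j s (sigma c i j) (X j v) + s (delta c i 0) v).

Lemma word_act_scale c g v :
  word_act s X (ore_scale c g) v = s c (word_act s X g v).
Proof.
apply: (@ore_ext _ (fun g => word_act s X (ore_scale c g) v)
  (fun g => s c (word_act s X g v))) => [x y|x y|a m].
- by rewrite ore_scaleBr word_actBl.
- by rewrite (word_actBl _ sBl) sBr.
rewrite ore_scaleU; apply: etrans (word_actU X sBl _ _ _) _; rewrite -sA.
by congr (s c _); apply/esym/word_actU.
Qed.

Lemma word_act_mulX i g v :
  word_act s X (ore_mulX i g) v = X i (word_act s X g v).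
Proof.
apply: (@ore_ext _ (fun g => word_act s X (ore_mulX i g) v)
  (fun g => X i (word_act s X g v))) => [x y|x y|a m].
- by rewrite ore_mulXB word_actBl.
- by rewrite (word_actBl _ sBl) XB.
rewrite ore_mulXU; apply: etrans (morphB_D (word_actBl _ sBl v) _ _) _.
apply: etrans (esym (f_equal (X i) (word_actU X sBl a m v))); rewrite Xs.
congr (_ + _); last exact: word_actU.
apply: etrans (morphB_sum _ _ (word_actBl _ sBl v)) _; apply: eq_bigr => j _.
by apply: etrans (word_actU X sBl _ _ _) _; rewrite fmM fmU.
Qed.

Lemma word_act_mul f g v :
  word_act s X (ore_mul f g) v = word_act s X f (word_act s X g v).
Proof.
apply: (@ore_ext _ (fun f => word_act s X (ore_mul f g) v)
  (fun f => word_act s X f (word_act s X g v))) => [x y|x y|a m].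
- by rewrite /ore_mul (word_actBl _ ore_scaleBl) word_actBl.
- by rewrite word_actBl.
apply: etrans (esym (word_actU X sBl _ _ _)).
have -> : ore_mul << a *g m >> g = ore_scale a (foldr ore_mulX g m).
  exact: word_actU ore_scaleBl _ _ _.
apply: etrans (word_act_scale _ _ _) _; congr (s a _).
by elim: (m : seq _) => //= i r IH; rewrite word_act_mulX IH.
Qed.

End Module.

Lemma ore_mulA : associative ore_mul.
Proof.
move=> f g h; rewrite {1 2}/ore_mul; symmetry; apply: word_act_mul.
- exact: ore_scaleBl.
- exact: ore_scaleBr.
- exact: ore_mulXB.
- exact: ore_scaleA.
- exact: ore_mulX_scale.
Qed.

Lemma ore_mulBl h : {morph ore_mul^~ h : f g / f - g}.
Proof. exact: (word_actBl _ ore_scaleBl). Qed.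

Lemma ore_mulBr f : {morph ore_mul f : g h / g - h}.
Proof. exact: (word_actBr ore_scaleBr ore_mulXB). Qed.

Lemma ore_mulDl : left_distributive ore_mul +%R.
Proof. by move=> f g h; apply: (morphB_D (ore_mulBl h)). Qed.

Lemma ore_mulDr : right_distributive ore_mul +%R.
Proof. by move=> f; apply: (morphB_D (ore_mulBr f)). Qed.

Lemma ore_mulC c g : ore_mul << c *g mone >> g = ore_scale c g.
Proof. by rewrite /ore_mul (word_actU _ ore_scaleBl) fm1. Qed.

Lemma ore_mul1 : left_id ore_one ore_mul.
Proof. by move=> g; rewrite /ore_one ore_mulC ore_scale1. Qed.

Lemma sderiv1 i : delta 1 i 0 = 0.
Proof.
have := sderivM delta 1 1; rewrite mulr1 rmorph1 mul1mx.
move=> /(congr1 (fun u : 'cV_n => u i 0)); rewrite !mxE mulr1.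
by rewrite -[LHS]addr0 => /addrI <-.
Qed.

Lemma ore_mulX_word1 i m : ore_mulX i << 1 *g m >> = << 1 *g mmul (fmu i) m >>.
Proof.
rewrite ore_mulXU sderiv1 monalgU0 addr0 rmorph1 (bigD1 i) //= mxE eqxx big1 ?addr0 //.
by move=> j ji; rewrite mxE eq_sym (negbTE ji) monalgU0.
Qed.

Lemma foldr_ore_mulX (m k : {fmonom 'I_n}) :
  foldr ore_mulX << 1 *g k >> m = << 1 *g mmul m k >>.
Proof.
elim/fmonom_ind: m => [|i m IH]; first by rewrite fm1 mul1m.
by rewrite fmM fmU /= IH ore_mulX_word1 mulmA.
Qed.

Lemma ore_mulr1 : right_id ore_one ore_mul.
Proof.
move=> f; apply: (@ore_ext _ (ore_mul^~ ore_one) id (ore_mulBl _)) => // c m.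
rewrite /ore_mul (word_actU _ ore_scaleBl) /ore_one foldr_ore_mulX.
by rewrite ore_scaleU mulr1 mulm1.
Qed.

End OreProduct.

(* The phantom argument [delta] selects the product. *)
Definition ore (A : pzRingType) (n : nat) (sigma : {rmorphism A -> 'M[A]_n})
  (delta : sigma_derivation sigma) : Type := {malg A[{fmonom 'I_n}]}.

Section Ore.
Context (A : pzRingType) (n : nat) (sigma : {rmorphism A -> 'M[A]_n}).
Context (delta : sigma_derivation sigma).
Local Notation ore := (ore delta).

HB.instance Definition _ := GRing.Zmodule.on ore.
HB.instance Definition _ := GRing.Zmodule_isPzRing.Build ore
  (ore_mulA delta) (ore_mul1 delta) (ore_mulr1 delta)
  (ore_mulDl delta) (ore_mulDr delta).

Definition oreC (c : A) : ore := << c *g mone >>.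
Definition oreX (i : 'I_n) : ore := mkmalgU (fmu i) 1.

(* With [oreCU], [ore_word] and distributivity, this rule determines the product:
   [ore delta] is the Ore extension. *)
Lemma ore_commute i a :
  oreX i * oreC a = \sum_j oreC (sigma a i j) * oreX j + oreC (delta a i 0).
Proof.
rewrite [LHS](word_actU _ (@ore_scaleBl _ _)) fmU /= ore_scale1 ore_mulXU; congr (_ + _).
apply: eq_bigr => j _; rewrite [RHS]ore_mulC ore_scaleU mulr1.
by rewrite mulm1.
Qed.

Lemma ore_word (m k : {fmonom 'I_n}) :
  (<< 1 *g m >> : ore) * << 1 *g k >> = << 1 *g mmul m k >>.
Proof. by rewrite [LHS](word_actU _ (@ore_scaleBl _ _)) foldr_ore_mulX ore_scale1. Qed.

Lemma oreC_is_zmod_morphism : zmod_morphism oreC.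
Proof. by move=> a b; rewrite /oreC monalgUB. Qed.
HB.instance Definition _ :=
  GRing.isZmodMorphism.Build A ore oreC oreC_is_zmod_morphism.

Lemma oreC_is_monoid_morphism : monoid_morphism oreC.
Proof. by split=> // a b; rewrite [RHS]ore_mulC ore_scaleU. Qed.
HB.instance Definition _ :=
  GRing.isMonoidMorphism.Build A ore oreC oreC_is_monoid_morphism.

Lemma oreCU c (m : {fmonom 'I_n}) : (<< c *g m >> : ore) = oreC c * << 1 *g m >>.
Proof. by rewrite [RHS]ore_mulC ore_scaleU mulr1. Qed.

Definition oreT (a : 'cV[A]_n) (i : 'I_n) (b : A) : A :=
  \sum_j sigma b i j * a j 0 + delta b i 0.

Definition ore_evalT (f : ore) (a : 'cV[A]_n) : A -> A :=
  word_act *%R (oreT a) f.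

Lemma oreT_is_zmod_morphism a i : zmod_morphism (oreT a i).
Proof.
move=> b c; rewrite /oreT !raddfB !mxE opprD addrACA -sumrB; congr (_ + _).
by apply: eq_bigr => j _; rewrite !mxE mulrBl.
Qed.
HB.instance Definition _ a i :=
  GRing.isZmodMorphism.Build A A (oreT a i) (oreT_is_zmod_morphism a i).

Lemma mulBl_morph (y : A) : {morph *%R^~ y : c d / c - d}.
Proof. by move=> c d; rewrite mulrBl. Qed.

Lemma mulBr_morph (c : A) : {morph *%R c : y z / y - z}.
Proof. by move=> y z; rewrite mulrBr. Qed.

Lemma ore_evalT_is_zmod_morphism f a : zmod_morphism (ore_evalT f a).
Proof.
apply: (@word_actBr _ _ _ *%R (oreT a) mulBr_morph).
exact: oreT_is_zmod_morphism.
Qed.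
HB.instance Definition _ f a :=
  GRing.isZmodMorphism.Build A A (ore_evalT f a) (ore_evalT_is_zmod_morphism f a).

Definition eval_ideal (a : 'cV[A]_n) (f : ore) : Prop :=
  exists g : 'I_n -> ore, f = \sum_i g i * (oreX i - oreC (a i 0)).

Lemma oreT_mul a i c b : oreT a i (c * b) =
  \sum_j sigma c i j * oreT a j b + delta c i 0 * b.
Proof.
rewrite /oreT rmorphM sderivM !mxE addrA; congr (_ + _).
transitivity (\sum_j (\sum_k sigma c i j * (sigma b j k * a k 0)
                      + sigma c i j * delta b j 0)); last first.
  by apply: eq_bigr => j _; rewrite mulrDr mulr_sumr.
rewrite big_split exchange_big /=; congr (_ + _).
by apply: eq_bigr => k _; rewrite !mxE mulr_suml; apply: eq_bigr => j _; rewrite mulrA.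
Qed.

Lemma ore_evalTM f g a y : ore_evalT (f * g) a y = ore_evalT f a (ore_evalT g a y).
Proof.
apply: word_act_mul.
- exact: mulBl_morph.
- exact: mulBr_morph.
- exact: oreT_is_zmod_morphism.
- exact: mulrA.
- exact: oreT_mul.
Qed.

Lemma ore_evalTB f g a y :
  ore_evalT (f - g) a y = ore_evalT f a y - ore_evalT g a y.
Proof. exact: (word_actBl _ mulBl_morph). Qed.

Lemma ore_evalTC c a y : ore_evalT (oreC c) a y = c * y.
Proof. by rewrite /ore_evalT (word_actU _ mulBl_morph) fm1. Qed.

Lemma ore_evalTX i a y : ore_evalT (oreX i) a y = oreT a i y.
Proof. by rewrite /ore_evalT (word_actU _ mulBl_morph) fmU /= mul1r. Qed.

Lemma eval_ideal0 a : eval_ideal a 0.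
Proof. by exists (fun=> 0); rewrite big1 // => i _; rewrite mul0r. Qed.

Lemma eval_idealD a f g : eval_ideal a f -> eval_ideal a g -> eval_ideal a (f + g).
Proof.
move=> [u ->] [v ->]; exists (fun i => u i + v i); rewrite -big_split.
by apply: eq_bigr => i _; rewrite mulrDl.
Qed.

Lemma eval_idealMl a f g : eval_ideal a g -> eval_ideal a (f * g).
Proof.
move=> [u ->]; exists (fun i => f * u i); rewrite mulr_sumr.
by apply: eq_bigr => i _; rewrite mulrA.
Qed.

Lemma eval_ideal_sum a (I : Type) (r : seq I) (F : I -> ore) :
  (forall i, eval_ideal a (F i)) -> eval_ideal a (\sum_(i <- r) F i).
Proof.
by move=> aF; apply: big_ind => //; [exact: eval_ideal0 | exact: eval_idealD].
Qed.

Lemma eval_idealX a i : eval_ideal a (oreX i - oreC (a i 0)).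
Proof.
exists (fun j => (j == i)%:R); rewrite (bigD1 i) //= eqxx mul1r big1 ?addr0 //.
by move=> j /negbTE ->; rewrite mul0r.
Qed.

Lemma eval_ideal_evalT a f : eval_ideal a f -> ore_evalT f a 1 = 0.
Proof.
move=> [g ->]; rewrite (morphB_sum _ _ (fun f g => ore_evalTB f g a 1)) big1 // => i _.
rewrite ore_evalTM ore_evalTB ore_evalTX ore_evalTC mulr1.
have -> : oreT a i 1 = a i 0.
  rewrite /oreT sderiv1 addr0 rmorph1 (bigD1 i) //= mxE eqxx mul1r big1 ?addr0 //.
  by move=> j ji; rewrite mxE eq_sym (negbTE ji) mul0r.
by rewrite subrr raddf0.
Qed.

Lemma eval_ideal_sub a f : eval_ideal a (f - oreC (ore_evalT f a 1)).
Proof.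
have mono (m : {fmonom 'I_n}) :
    eval_ideal a ((<< 1 *g m >> : ore) - oreC (foldr (oreT a) 1 m)).
  elim/fmonom_ind: m => [|i m IH]; first by rewrite fm1 subrr; exact: eval_ideal0.
  rewrite fmM fmU /= -ore_word; set c := foldr _ _ _ in IH *.
  rewrite -[X in X - _](subrK (oreX i * oreC c)) -mulrBr -addrA.
  apply: eval_idealD; first exact: eval_idealMl.
  rewrite ore_commute /oreT raddfD opprD addrACA subrr addr0 raddf_sum -sumrB.
  apply: eval_ideal_sum => j; rewrite -[X in _ - X]/(oreC _) rmorphM -mulrBr.
  by apply/eval_idealMl/eval_idealX.
rewrite {1}(oreE f) /ore_evalT word_actE raddf_sum -sumrB.
apply: eval_ideal_sum => m.
by rewrite -[X in _ - X]/(oreC _) oreCU rmorphM -mulrBr; apply: eval_idealMl.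
Qed.

Lemma ore_eval_exists_unique (f : ore) (a : 'cV[A]_n) :
  exists! c : A, eval_ideal a (f - oreC c).
Proof.
exists (ore_evalT f a 1); split; first exact: eval_ideal_sub.
move=> c /eval_ideal_evalT; rewrite ore_evalTB ore_evalTC mulr1.
by move/eqP; rewrite subr_eq0 => /eqP.
Qed.

Definition ore_eval (f : ore) (a : 'cV[A]_n) : A :=
  sval (cid (ore_eval_exists_unique f a)).

Lemma ore_evalP (f : ore) (a : 'cV[A]_n) (c : A) :
  eval_ideal a (f - oreC c) <-> ore_eval f a = c.
Proof.
rewrite /ore_eval; case: cid => d [fd du] /=; split=> [/du //|<- //].
Qed.

(* a^x, with [xinv] the inverse of the unit x: units of a [pzRingType] carry
   no library inverse. *)
Definition ore_conj (a : 'cV[A]_n) (x xinv : A) : 'cV[A]_n :=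
  cvmulr (sigma x *m a) xinv + cvmulr (delta x) xinv.

End Ore.

(* Main.v *)
(** The map [y |-> y x] intertwines T_b and T_a, since
    T_a(yx) = sigma(y) T_a(x) + delta(y) x and T_a(x) = b x; hence it
    intertwines f(T_b) and f(T_a) for every f. As f(b) = f(T_b)(1), taking
    y = 1 gives f(b) x = f(T_a)(x), and x can be cancelled. *)

Require Import Defs.
From mathcomp Require Import all_boot all_order all_algebra.

Set Implicit Arguments.
Unset Strict Implicit.
Unset Printing Implicit Defensive.

Import GRing.Theory.
Local Open Scope ring_scope.

Lemma not_zero_divisorP (A : pzRingType) (x y : A) :
  ~ zero_divisor x -> y * x = 0 -> y = 0.
Proof.
move=> nzd yx0; have [//|y_neq0] := eqVneq y 0.
by case: nzd; exists y; last right.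
Qed.

Lemma inv_not_zero_divisor (A : pzRingType) (x xinv : A) :
  x * xinv = 1 -> xinv * x = 1 -> ~ zero_divisor x.
Proof.
move=> xV Vx [y /eqP y_neq0 [xy0|yx0]]; apply: y_neq0.
- by rewrite -[y]mul1r -Vx -mulrA xy0 mulr0.
- by rewrite -[y]mulr1 -xV mulrA yx0 mul0r.
Qed.

Section Intertwining.
Context (A : pzRingType) (n : nat) (sigma : {rmorphism A -> 'M[A]_n}).
Context (delta : sigma_derivation sigma).
Implicit Types (f : ore delta) (a b : 'cV[A]_n) (x y : A).

(** The constant [ore_evalT f a 1] is congruent to [f] modulo the left ideal of [a], and each class
    contains only one constant. *)
Lemma ore_eval_evalT f a : ore_eval f a = ore_evalT f a 1.
Proof. exact/ore_evalP/eval_ideal_sub. Qed.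

(** Makes the unit case an instance of the general one, with [b] the conjugate of [a] by [x]. *)
Lemma cvmulr_ore_conj a x xinv : xinv * x = 1 ->
  cvmulr (ore_conj delta a x xinv) x = sigma x *m a + delta x.
Proof.
move=> Vx; apply/colP=> i.
by rewrite !mxE mulrDl -!mulrA Vx !mulr1.
Qed.

(** The one-letter case of the intertwining, obtained from the twisted Leibniz rule [oreT_mul]. *)
Lemma oreT_mulr a b x i y : cvmulr b x = sigma x *m a + delta x ->
  oreT delta b i y * x = oreT delta a i (y * x).
Proof.
move=> bx; rewrite oreT_mul mulrDl mulr_suml; congr (_ + _).
apply: eq_bigr => j _; rewrite -mulrA; congr (_ * _).
(* Entry [j] of the hypothesis reads [b j 0 * x = oreT delta a j x]. *)
by have /colP/(_ j) := bx; rewrite !mxE.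
Qed.

Lemma ore_evalT_mulr f a b x y : cvmulr b x = sigma x *m a + delta x ->
  ore_evalT f b y * x = ore_evalT f a (y * x).
Proof.
move=> bx; rewrite /ore_evalT !word_actE mulr_suml.
apply: eq_bigr => m _; rewrite -mulrA; congr (_ * _).
(* Induction on the word: once its tail is moved past [x], only the outermost letter remains. *)
by elim: (monalg.fmonom_val m) => //= i w <-; apply: oreT_mulr.
Qed.

Lemma ore_evalT_eq0 f a b x : ~ zero_divisor x ->
  cvmulr b x = sigma x *m a + delta x ->
  ore_evalT f a x = 0 <-> ore_eval f b = 0.
Proof.
move=> nzd bx; rewrite ore_eval_evalT -{1}[x]mul1r -(ore_evalT_mulr _ _ bx).
by split=> [/(not_zero_divisorP nzd) //|->]; rewrite mul0r.
Qed.

End Intertwining.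

Theorem proposition4p5 (A : pzRingType) (n : nat) (n_gt0 : (0 < n)%N)
    (sigma : {rmorphism A -> 'M[A]_n}) (delta : sigma_derivation sigma)
    (f : ore delta) :
  (forall (a b : 'cV[A]_n) (x : A),
     ~ zero_divisor x ->
     cvmulr b x = sigma x *m a + delta x ->
     (forall y : A, ore_evalT f b y * x = ore_evalT f a (y * x)) /\
     (ore_evalT f a x = 0 <-> ore_eval f b = 0)) /\
  (forall (a : 'cV[A]_n) (x xinv : A),
     x * xinv = 1 -> xinv * x = 1 ->
     (ore_evalT f a x = 0 <-> ore_eval f (ore_conj delta a x xinv) = 0)).
Proof.
split=> [a b x nzd bx|a x xinv xV Vx].
  by split=> [y|]; [apply: ore_evalT_mulr | apply: ore_evalT_eq0].
apply: ore_evalT_eq0; first exact: inv_not_zero_divisor xV Vx.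
exact: cvmulr_ore_conj.
Qed.
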